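(* Let $C$ be an extended linear code of length $5$ over $\mathbb{Z}_N$ and let $g=(g_{ji})$ be an $m\times5$ matrix that generates $C$, with columns indexed by $i=0,\dots,4$, such that the greatest common divisor of $N$ and all the entries of $g$ is $1$. Put $\gcd_i=\gcd(g_{1i},\dots,g_{mi},N)$. If $C$ is thin, then at least one of the $\gcd_i$ is $N/\alpha$ with $\alpha\in\{2,3,4\}$.
   Context: $\mathbb{Z}_N=\mathbb{Z}/N\mathbb{Z}$; its elements are identified with the representatives $0,1,\dots,N-1$, and gcd's are taken of these integers. A linear code of length $n$ over $\mathbb{Z}_N$ is a submodule $C\subseteq\mathbb{Z}_N^n$; its elements are called words; a matrix generates $C$ if its rows generate $C$. $C$ is extended if every word has coordinate sum $0\bmod N$. An extended code is thin if it contains no word all of whose entries are nonzero.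
   Formalization: The formal theorem additionally assumes N > 1 and that no coordinate of C is identically zero (no gcd_i equals N); without this the claim fails, e.g. N = 5 and g = (1 4 0 0 0), which is thin with gcds 1, 1, 5, 5, 5. *)

(* Defs.v *)
From HB Require Import structures.
From mathcomp Require Import all_boot all_order all_algebra.

Set Implicit Arguments.
Unset Strict Implicit.
Unset Printing Implicit Defensive.

Import GRing.Theory.
Local Open Scope ring_scope.

(* 'Z_N is the ring of integers mod N only for 1 < N; the coercion of          *)
(* x : 'Z_N to nat is then the representative of x in {0, ..., N-1}.           *)

Section Codes.

Variables (N n : nat).

Implicit Type C : {pred 'rV['Z_N]_n}.

Definition linear_code C : Prop := submod_closed C.

Definition generates m (g : 'M['Z_N]_(m, n)) C : Prop :=
  forall w : 'rV['Z_N]_n,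
    w \in C <-> exists a : 'I_m -> 'Z_N, w = \sum_(j < m) a j *: row j g.

Definition extended C : Prop :=
  forall w : 'rV['Z_N]_n, w \in C -> \sum_(i < n) w 0 i = 0.

Definition thin C : Prop :=
  ~ exists2 w : 'rV['Z_N]_n, w \in C & forall i : 'I_n, w 0 i != 0.

(* A code with an identically zero coordinate is trivially thin: the code      *)
(* {(a, -a, 0, 0, 0)} over Z/5 is thin with column gcds 1, 1, 5, 5, 5, so      *)
(* thinness bounds the column gcds only when this degeneracy is excluded.      *)
Definition no_zero_coordinate C : Prop :=
  forall i : 'I_n, exists2 w : 'rV['Z_N]_n, w \in C & w 0 i != 0.

(* gcdn has neutral element 0.                                                 *)
Definition col_gcd m (g : 'M['Z_N]_(m, n)) (i : 'I_n) : nat :=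
  gcdn (\big[gcdn/0%N]_(j < m) (g j i : nat)) N.

Definition total_gcd m (g : 'M['Z_N]_(m, n)) : nat :=
  gcdn N (\big[gcdn/0%N]_(j < m) \big[gcdn/0%N]_(i < n) (g j i : nat)).

End Codes.

(* Main.v *)
(** With [d_i] the i-th column gcd, Bezout gives a word of [C] whose i-th entry
    is [d_i].  If [N / d_i >= 5], the translates of the words vanishing at [i]
    by the multiples [0, ..., 4] of that word are disjoint, so at most a fifth
    of [C] vanishes at [i].  If this holds for all five coordinates, the five
    sets of vanishing words cannot cover [C], because they all contain the zero
    word; hence [C] is not thin. *)

Require Import Defs.
From HB Require Import structures.
From mathcomp Require Import all_boot all_order all_algebra.
From mathcomp Require Import zify.

Import GRing.Theory.
Local Open Scope ring_scope.

Definition vanishing {R : finNzRingType} {n : nat} (C : {pred 'rV[R]_n})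
  (i : 'I_n) : {set 'rV[R]_n} := [set w : 'rV[R]_n | (w \in C) && (w 0 i == 0)].

(** The last hypothesis says that [x 0 i] has additive order at least [k], so coordinate [i] tells
    the [k] translates apart. *)
Lemma card_vanishing_le {R : finNzRingType} {n : nat} {C : {pred 'rV[R]_n}}
    {i : 'I_n} {x : 'rV[R]_n} {k : nat} :
    submod_closed C -> x \in C ->
    (forall j : nat, (0 < j < k)%N -> x 0 i *+ j != 0) ->
  (k * #|vanishing C i| <= #|C|)%N.
Proof.
move=> [_ lin] Cx ordx.
(* One inequality is enough: exchanging [j] and [j'] yields the other. *)
have inj (j j' : 'I_k) : x 0 i *+ j = x 0 i *+ j' -> (j <= j')%N.
  move=> eqj; rewrite leqNgt; apply/negP=> lt_j.
  have := ordx (j - j')%N; rewrite subn_gt0 lt_j (leq_ltn_trans (leq_subr _ _)) //.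
  by rewrite mulrnBr 1?ltnW // eqj subrr eqxx => /(_ isT).
pose f (p : 'rV[R]_n * 'I_k) := p.2%:R *: x + p.1.
have f_i (w : 'rV[R]_n) (j : 'I_k) :
    w \in vanishing C i -> f (w, j) 0 i = x 0 i *+ j.
  by rewrite inE !mxE /= => /andP[_ /eqP ->]; rewrite addr0 mulr_natl.
have f_inj : {in setX (vanishing C i) [set: 'I_k] &, injective f}.
  move=> [w j] [w' j'] /setXP[Zw _] /setXP[Zw' _] eqf.
  have eqj : x 0 i *+ j = x 0 i *+ j' by rewrite -(f_i w) // -(f_i w') // eqf.
  have {}eqj : j = j' by apply/val_inj/eqP; rewrite eqn_leq !inj.
  by move: eqf; rewrite eqj /f /= => /addrI ->.
rewrite mulnC -[k in (_ * k)%N]card_ord -[#|'I_k|]cardsT -cardsX.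
rewrite -(card_in_imset f_inj).
apply/subset_leq_card/subsetP=> _ /imsetP[[w j] /setXP[+ _] ->].
by rewrite inE => /andP[Cw _]; apply: lin.
Qed.

(** Discarding the zero word from [C] and from each vanishing set, a cover would give [#|C| - 1 <= n
    * (#|C| / n - 1) = #|C| - n], impossible for [1 < n]. *)
Lemma nowhere_zero_word {R : finNzRingType} {n : nat} {C : {pred 'rV[R]_n}} :
    (1 < n)%N -> 0 \in C -> (forall i, n * #|vanishing C i| <= #|C|)%N ->
  exists2 w : 'rV[R]_n, w \in C & forall i, w 0 i != 0.
Proof.
move=> n_gt1 C0 leZ.
case: (boolP [exists w : 'rV[R]_n, (w \in C) && [forall i, w 0 i != 0]]).
  by case/existsP=> w /andP[Cw /forallP nz]; exists w.
move=> noword.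
have cover : [set w in C] :\ 0 \subset \bigcup_i (vanishing C i :\ 0).
  apply/subsetP=> w; rewrite !inE => /andP[w_n0 Cw].
  move/existsPn/(_ w): noword; rewrite Cw /= negb_forall => /existsP[i].
  by rewrite negbK => wi; apply/bigcupP; exists i; rewrite // !inE w_n0 Cw.
have cardC : #|C| = #|[set w in C] :\ 0|.+1.
  by rewrite -[LHS]cardsE (cardsD1 (0 : 'rV[R]_n)) inE C0.
have leC : (#|[set w in C] :\ 0%R| <= \sum_i #|vanishing C i :\ 0%R|)%N.
  apply: leq_trans (subset_leq_card cover) _.
  apply: (big_ind2 (fun (A : {set 'rV[R]_n}) a => #|A| <= a)%N) => //.
    by rewrite cards0.
  move=> A a B b leA leB.
  by apply: leq_trans (leq_card_setU A B) _; apply: leq_add.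
have leZ' i : (n * #|vanishing C i :\ 0%R| + n <= #|C|)%N.
  have := leZ i; rewrite (cardsD1 0) inE C0 mxE eqxx /=.
  by rewrite mulnDr muln1 addnC.
have : (\sum_(i < n) (n * #|vanishing C i :\ 0%R| + n) <= \sum_(i < n) #|C|)%N.
  exact: leq_sum.
rewrite big_split -big_distrr !sum_nat_const card_ord /=.
(* With [S] the number of nonzero words and [T] the sum over [i], the hypothesis reads
   [n * T + n * n <= n * S + n], against [S <= T] and [n < n * n]. *)
rewrite cardC mulnS addnC leqNgt => /negP[].
rewrite -addSn leq_add ?leq_mul2l ?leC ?orbT //.
by rewrite ltn_Pmull // ltnW.
Qed.

Lemma natr_Zp_eq0 {N k : nat} : (1 < N)%N -> (k%:R == 0 :> 'Z_N) = (N %| k)%N.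
Proof. by move=> hN; rewrite -val_eqE /= val_Zp_nat. Qed.

(** The naturals whose residues occur as [i]-th entries of words of [C] contain [0] and the entries
    of column [i], and are closed under [gcdn]. *)
Lemma col_gcd_word {N n : nat} {C : {pred 'rV['Z_N]_n}} {m : nat}
    {g : 'M['Z_N]_(m, n)} (i : 'I_n) :
    (1 < N)%N -> submod_closed C -> (forall j, row j g \in C) ->
  exists2 w : 'rV['Z_N]_n, w \in C & w 0 i = (col_gcd g i)%:R.
Proof.
move=> hN [C0 lin] Cg.
pose P d := exists2 w : 'rV['Z_N]_n, w \in C & w 0 i = d%:R.
have P0 : P 0%N by exists 0; rewrite // mxE.
have Pgcd a b : P a -> P b -> P (gcdn a b).
  case: (posnP a) => [->|a_gt0]; first by rewrite gcd0n.
  move=> [u Cu ui] [v Cv vi].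
  (* Here [d * a = gcdn a b + c * b], whence the word [d u - c v]. *)
  have [c _ /dvdnP[d def_d]] := Bezoutl b a_gt0.
  exists (d%:R *: u + - c%:R *: v).
    by apply: (lin) => //; rewrite -[_ *: v]addr0; apply: lin.
  rewrite !mxE ui vi mulNr -!natrM -def_d natrD; exact: addrK.
(* The modulus [N] is the residue [0], attained by the zero word. *)
rewrite -/(P _); apply: (Pgcd); last by exists 0; rewrite // mxE pchar_Zp.
apply: (big_ind P) => // j _; exists (row j g); first exact: Cg.
by rewrite mxE natr_Zp.
Qed.

(** Were the gcd [N], column [i] of [g] would be zero, and with it coordinate [i] of every word.
    This excludes the quotient [1]. *)
Lemma col_gcd_lt {N n : nat} {C : {pred 'rV['Z_N]_n}} {m : nat}
    {g : 'M['Z_N]_(m, n)} (i : 'I_n) :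
    (1 < N)%N -> no_zero_coordinate C -> generates g C ->
  (col_gcd g i < N)%N.
Proof.
move=> hN nz hg; rewrite ltn_neqAle dvdn_leq ?dvdn_gcdr ?(ltnW hN) // andbT.
apply/eqP=> eqN; have [w /hg[a ->]] := nz i.
rewrite summxE big1 ?eqxx // => j _; rewrite !mxE -(natr_Zp (g j i)).
suff /eqP -> : ((g j i : nat)%:R == 0 :> 'Z_N) by rewrite mulr0.
rewrite natr_Zp_eq0 // -{1}eqN; apply: dvdn_trans (dvdn_gcdl _ _) _.
exact: (biggcdn_inf j).
Qed.

Local Close Scope ring_scope.

Theorem lemma3p1 (N : nat) (hN : (1 < N)%N)
    (C : {pred 'rV['Z_N]_5}) (hC : linear_code C) (hext : extended C)
    (hnd : no_zero_coordinate C)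
    (m : nat) (g : 'M['Z_N]_(m, 5)) (hg : generates g C)
    (hgcd : total_gcd g = 1%N) (hthin : thin C) :
  exists (i : 'I_5) (alpha : nat),
    [/\ alpha \in [:: 2; 3; 4], (alpha %| N)%N & col_gcd g i = (N %/ alpha)%N].
Proof.
case: (boolP [exists i, N %/ col_gcd g i \in [:: 2; 3; 4]]) => [|noalpha].
  case/existsP=> i alphaP; exists i, (N %/ col_gcd g i).
  have dvN : col_gcd g i %| N by apply: dvdn_gcdr.
  by rewrite dvdn_div // divnA // mulKn // ltnW.
case: hthin; apply: nowhere_zero_word => // [|i]; first by case: hC.
have Cg j : row j g \in C.
  apply/hg; exists (fun j' => (j' == j)%:R)%R.
  rewrite (bigD1 j) //= eqxx scale1r big1 ?addr0 // => j' /negbTE ->.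
  by rewrite scale0r.
have [x Cx xi] := col_gcd_word i hN hC Cg.
apply: (card_vanishing_le hC Cx) => j /andP[j_gt0 j_lt5].
rewrite xi -mulrnA natr_Zp_eq0 //.
have d_lt := col_gcd_lt i hN hnd hg.
have /dvdnP[q defN] : col_gcd g i %| N by apply: dvdn_gcdr.
have d_gt0 : 0 < col_gcd g i by rewrite gcdn_gt0 (ltnW hN) orbT.
move/existsPn/(_ i): noalpha; rewrite {1}defN mulnK // !inE.
(* Since [N = q * d] with [0 < d < N], [q] is at least [2], hence at least [5]; but [N %| d * j]
   with [0 < j] would force [q <= j < 5]. *)
move=> q_not; apply/negP => /dvdn_leq; nia.
Qed.
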